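(* Let $S$ be an idempotent semiring with zero $\mathbf 0$ and unity $\mathbf 1$ whose strong interval extension $\mathcal I(S)$ is well-defined (closed under the interval operations), let $\mathbf A\in \mathrm{Mat}_{nn}(\mathcal I(S))$ and $\mathbf B\in \mathrm{Mat}_{ns}(\mathcal I(S))$, and suppose that the closure matrix $A^*$ exists for every $A\in\mathbf A$. Then the interval matrix $\mathbf A^*\mathbf B\in \mathrm{Mat}_{ns}(I(S))$, considered as an element of $I(\mathrm{Mat}_{ns}(S))$, contains the united minimal solution set $\Sigma_{\min}(\mathbf A,\mathbf B)$ and is the least (with respect to inclusion) interval of $I(\mathrm{Mat}_{ns}(S))$ with this property. In particular, the bounds of the interval $\mathbf A^*\mathbf B$ belong to $\Sigma_{\min}(\mathbf A,\mathbf B)$.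
   Context: A semiring is a set $S$ with an associative commutative addition $\oplus$ and an associative multiplication $\odot$ that distributes over $\oplus$ on both sides; it is idempotent if $x\oplus x=x$ for all $x$. A unity is an element $\mathbf 1$ with $\mathbf 1\odot x=x\odot\mathbf 1=x$; a zero is an element $\mathbf 0\neq\mathbf 1$ with $\mathbf 0\oplus x=x$ and $\mathbf 0\odot x=x\odot\mathbf 0=\mathbf 0$. The canonical order is: $x\preccurlyeq y$ iff $x\oplus y=y$ (and $x\prec y$ iff $x\preccurlyeq y$, $x\ne y$). $\mathrm{Mat}_{mn}(S)$ is the set of $m\times n$ matrices over $S$, with entrywise sum $\oplus$, the corresponding canonical (entrywise) order $\preccurlyeq$, and product $(AB)_{ij}=\bigoplus_k a_{ik}\odot b_{kj}$. $E\in\mathrm{Mat}_{nn}(S)$ has $\mathbf 1$ on the diagonal and $\mathbf 0$ elsewhere. A (closed) interval in a partially ordered set is a set $[\underline{\mathbf x},\overline{\mathbf x}]=\{t:\underline{\mathbf x}\preccurlyeq t\preccurlyeq\overline{\mathbf x}\}$ with $\underline{\mathbf x}\preccurlyeq\overline{\mathbf x}$ (lower and upper bounds). The weak interval extension $I(S)$ is the set of all closed intervals in $S$ with operations $\mathbf x\star\mathbf y=[\underline{\mathbf x}\star\underline{\mathbf y},\overline{\mathbf x}\star\overline{\mathbf y}]$, $\star\in\{\oplus,\odot\}$; infinite sums of intervals are also taken bound by bound. $I(\mathrm{Mat}_{ns}(S))$ is the set of closed intervals in $\mathrm{Mat}_{ns}(S)$. The strong interval extension is $\mathcal I(S)=\{\mathbf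 x\in I(S):\mathbf 0\prec\underline{\mathbf x}\preccurlyeq\overline{\mathbf x}\}\cup\{[\mathbf 0,\mathbf 0]\}$ with the same operations. An interval matrix $\mathbf A=(\mathbf a_{ij})$ has lower matrix $\underline{\mathbf A}=(\underline{\mathbf a_{ij}})$ and upper matrix $\overline{\mathbf A}=(\overline{\mathbf a_{ij}})$ and is identified with the interval $[\underline{\mathbf A},\overline{\mathbf A}]$ of matrices; $A\in\mathbf A$ means $\underline{\mathbf A}\preccurlyeq A\preccurlyeq\overline{\mathbf A}$. The closure of a square matrix is $A^*=\bigoplus_{k\ge0}A^k=E\oplus A\oplus A^2\oplus\cdots$. That it exists means that this infinite sum is well defined: the supremum of the powers with respect to $\preccurlyeq$ exists and multiplication by matrices distributes over it, so that $A^*=AA^*\oplus E$ and $X=A^*B$ is the least solution of the discrete stationary Bellman equation $X=AX\oplus B$. For an interval matrix, $\mathbf A^*=\bigoplus_{k\ge0}\mathbf A^k=[\underline{\mathbf A}^*,\overline{\mathbf A}^*]$. The united minimal solution set is the set of minimal solutions of $X=AX\oplus B$ for $A\in\mathbf A$, $B\in\mathbf B$, i.e. $\Sigma_{\min}(\mathbf A,\mathbf B)=\{A^*B: A\in\mathbf A,\ B\in\mathbf B\}\subset\mathrm{Mat}_{ns}(S)$. *)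

(* Defs.v *)
From HB Require Import structures.
From mathcomp Require Import all_boot all_algebra.
From mathcomp Require Import boolp classical_sets.

Set Implicit Arguments.
Unset Strict Implicit.
Unset Printing Implicit Defensive.

Import GRing.Theory.
Local Open Scope classical_set_scope.
Local Open Scope ring_scope.

HB.mixin Record NzSemiRing_isIdempotent S of GRing.NzSemiRing S := {
  addxx : forall x : S, x + x = x
}.

#[short(type="idemSemiRingType")]
HB.structure Definition IdemSemiRing :=
  { S of NzSemiRing_isIdempotent S & GRing.NzSemiRing S }.

(* Stated for any commutative additive monoid so that it covers both the
   semiring S and the matrices over S, where it is the entrywise order. *)
Definition cle (V : nmodType) (x y : V) : bool := x + y == y.
Notation "x ≼ y" := (cle x y) (at level 70, no associativity) : ring_scope.

Definition clt (V : nmodType) (x y : V) : bool := (x ≼ y) && (x != y).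
Notation "x ≺ y" := (clt x y) (at level 70, no associativity) : ring_scope.

(* A closed interval is nonempty, hence determined by its bounds. *)
Record citv (V : nmodType) := Citv {
  bounds : V * V;
  boundsP : bounds.1 ≼ bounds.2
}.

Definition lo (V : nmodType) (I : citv V) : V := (bounds I).1.
Definition hi (V : nmodType) (I : citv V) : V := (bounds I).2.

Definition itv_set (V : nmodType) (I : citv V) : set V :=
  [set t | lo I ≼ t /\ t ≼ hi I].

HB.instance Definition _ (V : nmodType) := [isSub for @bounds V].
HB.instance Definition _ (V : nmodType) := [Choice of citv V by <:].

Section CanonicalOrder.
Variable S : idemSemiRingType.
Implicit Types x y : S.

Lemma cle_refl x : x ≼ x.
Proof. by rewrite /cle addxx. Qed.

Lemma cle_anti (V : nmodType) (x y : V) : x ≼ y -> y ≼ x -> x = y.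
Proof. by move=> /eqP xy /eqP yx; rewrite -xy addrC yx. Qed.

Lemma cle_trans (V : nmodType) (y x z : V) : x ≼ y -> y ≼ z -> x ≼ z.
Proof. by move=> /eqP xy /eqP yz; rewrite /cle -yz addrA xy. Qed.

Lemma cleD (V : nmodType) (x1 y1 x2 y2 : V) :
  x1 ≼ y1 -> x2 ≼ y2 -> x1 + x2 ≼ y1 + y2.
Proof. by move=> /eqP e1 /eqP e2; rewrite /cle addrACA e1 e2. Qed.

Lemma cleM x1 y1 x2 y2 : x1 ≼ y1 -> x2 ≼ y2 -> x1 * x2 ≼ y1 * y2.
Proof.
move=> /eqP e1 /eqP e2; apply: (@cle_trans _ (y1 * x2)).
  by rewrite /cle -mulrDl e1.
by rewrite /cle -mulrDr e2.
Qed.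

Lemma cle_mx m n (A B : 'M[S]_(m, n)) :
  (A ≼ B) = [forall i, forall j, A i j ≼ B i j].
Proof.
apply/eqP/forallP => [e i | H].
  by apply/forallP => j; rewrite /cle -{2}e !mxE.
by apply/matrixP => i j; move/forallP/(_ j)/eqP: (H i); rewrite !mxE.
Qed.

End CanonicalOrder.

Section WeakIntervalExtension.
Variable S : idemSemiRingType.
Implicit Types x y z : citv S.

Lemma citv_eq x y : lo x = lo y -> hi x = hi y -> x = y.
Proof.
by move=> l h; apply: val_inj; rewrite /= [bounds x]surjective_pairing -/(lo x)
  -/(hi x) l h -surjective_pairing.
Qed.

Definition itv_pt (a : S) : citv S := @Citv S (a, a) (cle_refl a).

Definition itv_add x y : citv S :=
  @Citv S (lo x + lo y, hi x + hi y) (cleD (boundsP x) (boundsP y)).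

Definition itv_mul x y : citv S :=
  @Citv S (lo x * lo y, hi x * hi y) (cleM (boundsP x) (boundsP y)).

Lemma itv_addA : associative itv_add.
Proof. by move=> x y z; apply: citv_eq; apply: addrA. Qed.
Lemma itv_addC : commutative itv_add.
Proof. by move=> x y; apply: citv_eq; apply: addrC. Qed.
Lemma itv_add0 : left_id (itv_pt 0) itv_add.
Proof. by move=> x; apply: citv_eq; apply: add0r. Qed.

HB.instance Definition _ :=
  GRing.isNmodule.Build (citv S) itv_addA itv_addC itv_add0.

Lemma itv_mulA : associative itv_mul.
Proof. by move=> x y z; apply: citv_eq; apply: mulrA. Qed.
Lemma itv_mul1x : left_id (itv_pt 1) itv_mul.
Proof. by move=> x; apply: citv_eq; apply: mul1r. Qed.
Lemma itv_mulx1 : right_id (itv_pt 1) itv_mul.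
Proof. by move=> x; apply: citv_eq; apply: mulr1. Qed.
Lemma itv_mulDl : left_distributive itv_mul +%R.
Proof. by move=> x y z; apply: citv_eq; apply: mulrDl. Qed.
Lemma itv_mulDr : right_distributive itv_mul +%R.
Proof. by move=> x y z; apply: citv_eq; apply: mulrDr. Qed.
Lemma itv_mul0x : left_zero (itv_pt 0) itv_mul.
Proof. by move=> x; apply: citv_eq; apply: mul0r. Qed.
Lemma itv_mulx0 : right_zero (itv_pt 0) itv_mul.
Proof. by move=> x; apply: citv_eq; apply: mulr0. Qed.

HB.instance Definition _ := GRing.Nmodule_isPzSemiRing.Build (citv S)
  itv_mulA itv_mul1x itv_mulx1 itv_mulDl itv_mulDr itv_mul0x itv_mulx0.

Lemma itv_1neq0 : (1 : citv S) != 0.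
Proof. by apply/eqP => /(congr1 (@lo S)) /eqP; rewrite (negbTE (oner_neq0 S)). Qed.

HB.instance Definition _ :=
  GRing.PzSemiRing_isNonZero.Build (citv S) itv_1neq0.

Lemma itv_addxx x : x + x = x.
Proof. by apply: citv_eq; apply: addxx. Qed.

HB.instance Definition _ := NzSemiRing_isIdempotent.Build (citv S) itv_addxx.

Definition strong_itv : {pred citv S} :=
  [pred x | (0 ≺ lo x) || (x == itv_pt 0)].

Definition strong_ext_well_defined : Prop :=
  {in strong_itv &, forall x y, x + y \in strong_itv} /\
  {in strong_itv &, forall x y, x * y \in strong_itv}.

End WeakIntervalExtension.

Section IntervalMatrices.
Variable S : idemSemiRingType.

Definition lo_mx m n (A : 'M[citv S]_(m, n)) : 'M[S]_(m, n) :=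
  map_mx (@lo S) A.
Definition hi_mx m n (A : 'M[citv S]_(m, n)) : 'M[S]_(m, n) :=
  map_mx (@hi S) A.

Lemma lo_hi_mx m n (A : 'M[citv S]_(m, n)) : lo_mx A ≼ hi_mx A.
Proof.
rewrite cle_mx; apply/forallP => i; apply/forallP => j.
by rewrite !mxE; exact: boundsP.
Qed.

Definition mx_itv m n (A : 'M[citv S]_(m, n)) : citv 'M[S]_(m, n) :=
  @Citv _ (lo_mx A, hi_mx A) (lo_hi_mx A).

Definition is_sup (V : nmodType) (u : nat -> V) (c : V) : Prop :=
  (forall k, u k ≼ c) /\ (forall d, (forall k, u k ≼ d) -> c ≼ d).

(* C is the infinite sum of the X k, the sum being well defined: it is the
   supremum, and matrix multiplication on either side distributes over it. *)
Definition is_infsum m n (X : nat -> 'M[S]_(m, n)) (C : 'M[S]_(m, n)) : Prop :=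
  [/\ is_sup X C,
      forall p (M : 'M[S]_(p, m)), is_sup (fun k => M *m X k) (M *m C) &
      forall p (N : 'M[S]_(n, p)), is_sup (fun k => X k *m N) (C *m N)].

(* 0 is a junk value, returned when the sum is not well defined. *)
Definition mx_infsum m n (X : nat -> 'M[S]_(m, n)) : 'M[S]_(m, n) :=
  xget 0 [set C | is_infsum X C].

Definition is_itv_infsum m n (X : nat -> 'M[citv S]_(m, n))
    (C : 'M[citv S]_(m, n)) : Prop :=
  is_infsum (fun k => lo_mx (X k)) (lo_mx C) /\
  is_infsum (fun k => hi_mx (X k)) (hi_mx C).

(* Same junk value as [mx_infsum]. *)
Definition itv_infsum m n (X : nat -> 'M[citv S]_(m, n)) : 'M[citv S]_(m, n) :=
  xget 0 [set C | is_itv_infsum X C].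

Definition has_mx_closure n (A : 'M[S]_n) : Prop :=
  exists C, is_infsum (fun k => A ^+ k) C.

Definition mx_closure n (A : 'M[S]_n) : 'M[S]_n := mx_infsum (fun k => A ^+ k).

Definition itv_mx_closure n (A : 'M[citv S]_n) : 'M[citv S]_n :=
  itv_infsum (fun k => A ^+ k).

Definition united_min_sol n s (A : 'M[citv S]_n) (B : 'M[citv S]_(n, s)) :
    set 'M[S]_(n, s) :=
  [set X | exists A' B', [/\ itv_set (mx_itv A) A', itv_set (mx_itv B) B' &
                             X = mx_closure A' *m B']].

Lemma is_infsum_uniq m n (X : nat -> 'M[S]_(m, n)) C D :
  is_infsum X C -> is_infsum X D -> C = D.
Proof.
by move=> [[uC lC] _ _] [[uD lD] _ _]; apply: cle_anti; [apply: lC|apply: lD].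
Qed.

Lemma mx_closureP n (A : 'M[S]_n) :
  has_mx_closure A -> is_infsum (fun k => A ^+ k) (mx_closure A).
Proof. by case=> C hC; rewrite /mx_closure /mx_infsum; apply: xgetPex; exists C. Qed.

Lemma mx_closure_fix n (A : 'M[S]_n) :
  has_mx_closure A -> mx_closure A = A *m mx_closure A + 1%:M.
Proof.
move=> /mx_closureP [[uC lC] dC _]; have [uA lA] := dC _ A.
apply: cle_anti.
- apply: lC => -[|k].
    rewrite expr0 /cle addrC -addrA.
    suff -> : 1%:M + 1 = 1 :> 'M[S]_n by [].
    by apply/matrixP => i j; rewrite !mxE addxx.
  have /eqP e := uA k; have -> : A ^+ k.+1 = A *m A ^+ k by rewrite exprS.
  by rewrite /cle addrA e.
- have h1 : A *m mx_closure A ≼ mx_closure A.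
    by apply: lA => k; have := uC k.+1; rewrite exprS.
  have h2 : 1%:M ≼ mx_closure A by have := uC 0%N; rewrite expr0.
  by move/eqP: h1 => e1; move/eqP: h2 => e2; rewrite /cle -addrA e2 e1.
Qed.

(* So, wherever the closures exist, [united_min_sol] is the set of the least
   (hence the only minimal) solutions of X = AX + B. *)
Lemma mx_closure_least_solution n s (A : 'M[S]_n) (B : 'M[S]_(n, s)) :
  has_mx_closure A ->
  mx_closure A *m B = A *m (mx_closure A *m B) + B /\
  forall X, X = A *m X + B -> mx_closure A *m B ≼ X.
Proof.
move=> hA; split.
  by rewrite {1}mx_closure_fix // mulmxDl mul1mx mulmxA.
move=> X eX; have [_ _ /(_ _ B) [_]] := mx_closureP hA; apply.
have addmx (Y : 'M[S]_(n, s)) : Y + Y = Y.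
  by apply/matrixP => i j; rewrite !mxE addxx.
elim=> [|k IH].
  by rewrite expr0 mul1mx /cle {1}eX addrCA addmx -eX.
have -> : A ^+ k.+1 *m B = A *m (A ^+ k *m B) by rewrite exprS mulmxA.
apply: (@cle_trans _ (A *m X)); first by rewrite /cle -mulmxDr (eqP IH).
by rewrite /cle {2}eX addrA addmx -eX.
Qed.

End IntervalMatrices.

(* Main.v *)
Require Import Defs.
From HB Require Import structures.
From mathcomp Require Import all_boot all_algebra.
From mathcomp Require Import boolp classical_sets.

Import GRing.Theory.
Local Open Scope classical_set_scope.
Local Open Scope ring_scope.

(** Everything in sight is monotone for the entrywise order, and everything in
    sight is computed bound by bound.

    Monotonicity: products of matrices are monotone in both factors, hence so
    are powers, and a supremum is monotone in the sequence; therefore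
    A' |-> A'^* is monotone wherever closures exist, and so is
    (A', B') |-> A'^* B'.  On the box of all A' in A and B' in B this map thus
    takes its least value at the two lower matrices and its greatest value at
    the two upper matrices.

    Bound by bound: taking the lower (or the upper) bound of an interval is a
    semiring morphism, so it commutes with matrix products and powers.  The
    interval closure A^* exists because the closures of the lower and upper
    matrices are comparable, and these are its bounds
    ([itv_mx_closure_bounds]).  Hence the bounds of A^* B are precisely those
    extreme values: they belong to the united minimal solution set and enclose
    it.  An interval that contains the set contains both bounds, hence, by
    transitivity, the whole of A^* B. *)

(** The bounds are declared as semiring morphisms so that the generic theory
    of [map_mx] applies to [lo_mx] and [hi_mx]. *)
Section BoundMorphisms.
Variable S : idemSemiRingType.

Fact lo_nmod_morphism : nmod_morphism (@lo S : citv S -> S).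
Proof. by []. Qed.
Fact lo_monoid_morphism : monoid_morphism (@lo S : citv S -> S).
Proof. by []. Qed.
HB.instance Definition _ :=
  GRing.isNmodMorphism.Build (citv S) S (@lo S) lo_nmod_morphism.
HB.instance Definition _ :=
  GRing.isMonoidMorphism.Build (citv S) S (@lo S) lo_monoid_morphism.

Fact hi_nmod_morphism : nmod_morphism (@hi S : citv S -> S).
Proof. by []. Qed.
Fact hi_monoid_morphism : monoid_morphism (@hi S : citv S -> S).
Proof. by []. Qed.
HB.instance Definition _ :=
  GRing.isNmodMorphism.Build (citv S) S (@hi S) hi_nmod_morphism.
HB.instance Definition _ :=
  GRing.isMonoidMorphism.Build (citv S) S (@hi S) hi_monoid_morphism.

End BoundMorphisms.

Section IntervalClosure.
Set Implicit Arguments.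
Unset Strict Implicit.
Variable S : idemSemiRingType.

Lemma cle_mx_refl m n (A : 'M[S]_(m, n)) : A ≼ A.
Proof. by apply/eqP/matrixP => i j; rewrite !mxE addxx. Qed.

Lemma mulmx_cle m n p (A A' : 'M[S]_(m, n)) (B B' : 'M[S]_(n, p)) :
  A ≼ A' -> B ≼ B' -> A *m B ≼ A' *m B'.
Proof.
move=> /eqP eA /eqP eB; apply: (@cle_trans _ (A' *m B)).
  by rewrite /cle -mulmxDl eA.
by rewrite /cle -mulmxDr eB.
Qed.

Lemma expmx_cle n (A A' : 'M[S]_n) k : A ≼ A' -> A ^+ k ≼ A' ^+ k.
Proof.
move=> leA; elim: k => [|k IH]; first by rewrite !expr0 cle_mx_refl.
by rewrite !exprS; apply: mulmx_cle.
Qed.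

Lemma is_sup_cle (V : nmodType) (u v : nat -> V) c d :
  (forall k, u k ≼ v k) -> is_sup u c -> is_sup v d -> c ≼ d.
Proof.
move=> leuv [_ least_c] [ub_d _]; apply: least_c => k.
exact: cle_trans (leuv k) (ub_d k).
Qed.

Lemma mx_closure_cle n (A A' : 'M[S]_n) :
  has_mx_closure A -> has_mx_closure A' ->
  A ≼ A' -> mx_closure A ≼ mx_closure A'.
Proof.
move=> /mx_closureP [supA _ _] /mx_closureP [supA' _ _] leA.
by apply: is_sup_cle supA supA' => k; apply: expmx_cle.
Qed.

Lemma lo_mxX n (A : 'M[citv S]_n) k : lo_mx (A ^+ k) = lo_mx A ^+ k.
Proof.
elim: k => [|k IH]; first by rewrite !expr0 /lo_mx map_mx1.
by rewrite !exprS -IH /lo_mx map_mxM.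
Qed.

Lemma hi_mxX n (A : 'M[citv S]_n) k : hi_mx (A ^+ k) = hi_mx A ^+ k.
Proof.
elim: k => [|k IH]; first by rewrite !expr0 /hi_mx map_mx1.
by rewrite !exprS -IH /hi_mx map_mxM.
Qed.

Lemma itv_mx_of_bounds m n (L U : 'M[S]_(m, n)) :
  L ≼ U -> exists C : 'M[citv S]_(m, n), lo_mx C = L /\ hi_mx C = U.
Proof.
rewrite cle_mx => /forallP leLU.
have leij i j : L i j ≼ U i j by move/forallP: (leLU i).
exists (\matrix_(i, j) @Citv S (L i j, U i j) (leij i j)).
by split; apply/matrixP => i j; rewrite !mxE.
Qed.

(** Monotonicity of the closure makes the closures of the two bounds into an
    interval matrix; this witnesses that the interval sum is well defined, so
    [itv_mx_closure] is not a junk value, and uniqueness of sums then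
    identifies its bounds. *)
Lemma itv_mx_closure_bounds n (A : 'M[citv S]_n) :
  has_mx_closure (lo_mx A) -> has_mx_closure (hi_mx A) ->
  lo_mx (itv_mx_closure A) = mx_closure (lo_mx A) /\
  hi_mx (itv_mx_closure A) = mx_closure (hi_mx A).
Proof.
move=> clL clU.
have eL : (fun k => lo_mx (A ^+ k)) = (fun k => lo_mx A ^+ k).
  by apply/funext => k; apply: lo_mxX.
have eU : (fun k => hi_mx (A ^+ k)) = (fun k => hi_mx A ^+ k).
  by apply/funext => k; apply: hi_mxX.
have [C [loC hiC]] := itv_mx_of_bounds (mx_closure_cle clL clU (lo_hi_mx A)).
have sumC : is_itv_infsum (fun k => A ^+ k) C.
  by rewrite /is_itv_infsum eL eU loC hiC; split; apply: mx_closureP.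
have : is_itv_infsum (fun k => A ^+ k) (itv_mx_closure A).
  by rewrite /itv_mx_closure /itv_infsum; apply: xgetPex; exists C.
rewrite /is_itv_infsum eL eU => -[sumL sumU]; split.
- exact: is_infsum_uniq sumL (mx_closureP clL).
- exact: is_infsum_uniq sumU (mx_closureP clU).
Qed.

Lemma lo_in_itv m n (A : 'M[citv S]_(m, n)) : itv_set (mx_itv A) (lo_mx A).
Proof. by split; [apply: cle_mx_refl | apply: lo_hi_mx]. Qed.

Lemma hi_in_itv m n (A : 'M[citv S]_(m, n)) : itv_set (mx_itv A) (hi_mx A).
Proof. by split; [apply: lo_hi_mx | apply: cle_mx_refl]. Qed.

Lemma itv_set_subset (V : nmodType) (J K : citv V) :
  itv_set K (lo J) -> itv_set K (hi J) -> itv_set J `<=` itv_set K.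
Proof.
move=> [leKJ _] [_ leJK] t [Jt tJ].
by split; [apply: cle_trans leKJ Jt | apply: cle_trans tJ leJK].
Qed.

End IntervalClosure.

Theorem theorem4 (S : idemSemiRingType) (n s : nat)
    (A : 'M[citv S]_n) (B : 'M[citv S]_(n, s)) :
  strong_ext_well_defined S ->
  A \is a mxOver (@strong_itv S) ->
  B \is a mxOver (@strong_itv S) ->
  (forall A' : 'M[S]_n, itv_set (mx_itv A) A' -> has_mx_closure A') ->
  let J : citv 'M[S]_(n, s) := mx_itv (itv_mx_closure A *m B) in
  [/\ united_min_sol A B `<=` itv_set J,
      forall K : citv 'M[S]_(n, s),
        united_min_sol A B `<=` itv_set K -> itv_set J `<=` itv_set K,
      united_min_sol A B (lo J) &
      united_min_sol A B (hi J)].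
Proof.
move=> _ _ _ cl J.
have clL := cl _ (lo_in_itv A); have clU := cl _ (hi_in_itv A).
have [closL closU] := itv_mx_closure_bounds clL clU.
have loJ : lo J = mx_closure (lo_mx A) *m lo_mx B.
  by rewrite -closL -map_mxM.
have hiJ : hi J = mx_closure (hi_mx A) *m hi_mx B.
  by rewrite -closU -map_mxM.
have solL : united_min_sol A B (lo J).
  by exists (lo_mx A), (lo_mx B); split; [apply: lo_in_itv..|].
have solU : united_min_sol A B (hi J).
  by exists (hi_mx A), (hi_mx B); split; [apply: hi_in_itv..|].
split=> // [X [A' [B' [inA [leB geB] ->]]] | K subK].
- have clA' := cl _ inA; have [leA geA] := inA.
  by split; rewrite ?loJ ?hiJ; apply: mulmx_cle => //; apply: mx_closure_cle.
- by apply: itv_set_subset; apply: subK.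
Qed.
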